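(* Let $p$ be a prime. If $G$ is a finite $p$-group such that $\mathrm{cod}(G)=\{1,p,p^{a-1},p^a\}$ for some $a\ge 4$, then the nilpotence class of $G$ is at most $a$.
   Context: For an irreducible complex character $\chi$ of a finite group $G$, the codegree of $\chi$ is $\mathrm{cod}(\chi)=|G:\ker\chi|/\chi(1)$, and $\mathrm{cod}(G)$ denotes the set of codegrees of the irreducible characters of $G$. *)

(* Defs.v *)
From mathcomp Require Import all_boot all_order all_algebra all_fingroup all_solvable all_field all_character.
Set Implicit Arguments. Unset Strict Implicit. Unset Printing Implicit Defensive.
Import GRing.Theory Num.Theory.
Local Open Scope ring_scope.

Definition codegree (gT : finGroupType) (G : {group gT}) (i : Iirr G) : algC :=
  (#|G : cfker 'chi[G]_i|%g)%:R / 'chi[G]_i 1%g.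

Definition cod (gT : finGroupType) (G : {group gT}) : pred algC :=
  fun c => [exists i : Iirr G, c == codegree i].

(* Main.v *)
Require Import Defs.
From mathcomp Require Import all_boot all_order all_algebra all_fingroup all_solvable all_field all_character.
From mathcomp Require Import zify.
Import GRing.Theory Num.Theory.
Local Open Scope ring_scope.

(** In fact the class is at most 4. As p^2 is not a codegree, G / G' is
    elementary abelian. The kernels of the irreducible characters meet trivially,
    so we may assume that G has a faithful one; as chi(1)^2 <= |G : Z(G)|, this
    gives |G| <= p^(2a-1). Suppose L_5(G) <> 1 and choose a nonlinear psi with
    L_3(G) <= K = ker psi, and put Y = Z(psi). Then psi(1)^2 = |G : Y|, |G'K/K| = p
    and Y/K is cyclic of order p^(1+t) with t <= 1. The codegree of psi is thus
    psi(1) p^(1+t) >= p^(a-1), so G/K is large and |G'| <= p^(3+t). As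
    L_2 > L_3 > L_4 > L_5 > 1, equality holds throughout: t = 1, K = L_3,
    |L_3 : L_4| = p, and G'/L_3 consists of p-th powers of elements of Y/L_3. Such
    p-th powers are central modulo L_4, so L_3 <= L_4, a contradiction. *)

Lemma codegree_mod {gT : finGroupType} {G N : {group gT}} (j : Iirr (G / N)%g) :
  (N <| G)%g -> codegree (mod_Iirr j) = codegree j.
Proof.
move=> nNG; rewrite /codegree mod_IirrE // cfMod1; congr (_%:R / _).
have [[sNG nN] sNK] := (andP nNG, cfker_mod 'chi_j nNG).
rewrite -{2}(cfModK nNG 'chi_j) cfker_quo //.
by rewrite index_quotient_eq ?cfker_sub // (subset_trans (subsetIr _ _)).
Qed.

Lemma irr1_pgroup {gT : finGroupType} {G : {group gT}} {p : nat} (i : Iirr G) :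
  prime p -> p.-group%g G -> exists f, 'chi_i 1%g = (p ^ f)%:R.
Proof.
move=> p_pr pG; have := dvd_irr1_cardG i.
rewrite irr1_degree (card_pgroup pG) dvdC_nat => /(dvdn_pfactor _ _ p_pr)[f _ ->].
by exists f.
Qed.

Lemma index_cfker_codegree {gT : finGroupType} {G : {group gT}} {i : Iirr G} {p k f : nat} :
  prime p -> 'chi_i 1%g = (p ^ f)%:R -> codegree i = (p ^ k)%:R ->
  #|G : cfker 'chi_i|%g = (p ^ (k + f))%N.
Proof.
move=> p_pr chi1 /(canRL (divfK (irr1_neq0 i))).
by rewrite chi1 -natrM -expnD => /eqP; rewrite eqr_nat => /eqP.
Qed.

(* Stated as an inclusion so that it passes to quotients. *)
Definition codegree_gap {gT : finGroupType} (p a : nat) (G : {group gT}) :=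
  forall i : Iirr G, exists2 k,
    codegree i = (p ^ k)%:R & (k <= 1)%N || (a.-1 <= k <= a)%N.

Lemma codegree_gap_quotient {gT : finGroupType} {p a : nat} {G N : {group gT}} :
  (N <| G)%g -> codegree_gap p a G -> codegree_gap p a (G / N)%G.
Proof.
move=> nNG gapG j; have [k ck gk] := gapG (mod_Iirr j).
by exists k => //; rewrite -(codegree_mod _ nNG).
Qed.

(** The codegree of a linear character is its order, so no linear character has order p^2, and hence
    none has order p^k with k > 1. Thus x^p lies in the kernel of every linear character, and these
    kernels meet in G'. *)
Lemma codegree_gap_expg {gT : finGroupType} {p a : nat} {G : {group gT}} (x : gT) :
  prime p -> (4 <= a)%N -> codegree_gap p a G -> x \in G ->
  (x ^+ p \in G^`(1))%g.
Proof.
move=> p_pr a4 gapG Gx; rewrite -cap_cfker_lin_irr; apply/bigcapP=> i lin_i.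
have [k ck gk] := gapG i.
have cardlin (j : Iirr G) l : 'chi_j \is a linear_char ->
    codegree j = (p ^ l)%:R -> #['chi_j]%CF = (p ^ l)%N.
  move=> lin_j; have := lin_char1 lin_j; rewrite -[1]/((p ^ 0)%:R) => chi1 cl.
  rewrite -[l]addn0 -(index_cfker_codegree p_pr chi1 cl) cforder_lin_char // exponent_cyclic.
    by rewrite card_quotient ?normal_norm ?cfker_normal.
  (* A linear character has centre G, so the cyclic group Z(chi) / ker chi is G / ker chi. *)
  have := cfcenter_cyclic 'chi_j; congr (cyclic (_ / _)).
  by apply/eqP; rewrite eqEsubset cfcenter_sub /=; apply/subsetP=> y Gy;
     rewrite irr_cfcenterE // (lin_char1 lin_j) normC_lin_char.
have chik := cardlin i k lin_i ck.
have [k1 | k2] := leqP k 1.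
  have : 'chi_i ^+ p = 1 :> 'CF(G).
    apply/eqP; rewrite -dvdn_cforder chik; case: (k) k1 => [|[|//]] _.
      by rewrite dvd1n.
    by rewrite expn1.
  move/cfunP/(_ x).
  rewrite cfkerEirr inE lin_charX // exp_cfunE // cfun1E Gx => ->.
  by rewrite (lin_char1 lin_i).
have [linG [cF [injF _ linF surjF] [_ _ cFX _ cFo]]] := lin_char_group G.
have [u chiu] := surjF _ lin_i.
have ou : #[u]%g = (p ^ k)%N by rewrite -cFo -chiu.
(* A power of a linear character of order at least p^3 has codegree p^2. *)
pose v := (u ^+ (p ^ (k - 2)))%g.
have ov : #[v]%g = (p ^ 2)%N.
  rewrite orderXdiv ou ?dvdn_exp2l; try lia.
  by rewrite -expnB ?prime_gt0 //; [congr (_ ^ _)%N; lia | lia].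
have [j chij] : exists j, cF v = 'chi_j.
  by apply/irrP/lin_char_irr/linF.
have [l cl gl] := gapG j.
have := cardlin j l; rewrite -chij linF => /(_ isT cl).
rewrite cFo ov => /eqP; rewrite eqn_exp2l ?prime_gt1 // => /eqP l2.
by move: gl; rewrite -l2; lia.
Qed.

(** If chi(1) = p^f and the codegree is p^k, then |G| = p^(k+f). As |Z(G)| >= p, the bound chi(1)^2
    <= |G : Z(G)| gives 2f + 1 <= k + f, so k + f <= 2k - 1 <= 2a - 1. *)
Lemma codegree_gap_faithful {gT : finGroupType} {p a : nat} {G : {group gT}}
    (i : Iirr G) :
  prime p -> p.-group%g G -> (2 <= a)%N -> codegree_gap p a G ->
  G != 1%g :> {set gT} -> cfaithful 'chi_i -> (#|G| <= p ^ (a.*2.-1))%N.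
Proof.
move=> p_pr pG a2 gapG ntG ffi; have [k ck gk] := gapG i.
have [f chi1] := irr1_pgroup i p_pr pG.
have := index_cfker_codegree p_pr chi1 ck; move: (ffi); rewrite cfaithfulE => /trivgP ->.
rewrite indexg1 => cardG; rewrite cardG leq_exp2l ?prime_gt1 //.
have := irr1_bound i => -[+ _]; rewrite (cfcenter_fful_irr ffi) chi1 -natrX ler_nat.
have ntZ : 'Z(G)%g != 1%g :> {set gT}.
  by apply: contra ntG => /eqP/(trivg_center_pgroup pG) ->.
have [_ /dvdn_leq pZ _] := pgroup_pdiv (pgroupS (center_sub G) pG) ntZ.
rewrite -(leq_pmul2l (cardG_gt0 'Z(G))) Lagrange ?center_sub // cardG.
move=> le_f; have: (p ^ (1 + f.*2) <= p ^ (k + f))%N.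
  apply: leq_trans le_f.
  by rewrite expnD expn1 leq_mul ?pZ // -expnM muln2.
by rewrite leq_exp2l ?prime_gt1 //; lia.
Qed.

(** Modulo L_(n+2), the group L_(n+1) lies in the group generated by p-th powers from Y. These
    powers are central modulo L_(n+3), hence so is L_(n+1), and L_(n+2) = [L_(n+1), G] falls into
    L_(n+3). *)
Lemma lcn_Mho1_central {gT : finGroupType} {p n : nat} {G Y : {group gT}} :
  p.-group%g G -> Y \subset G -> ([~: Y, G] \subset 'L_n.+2(G))%g ->
  #|'L_n.+2(G) : 'L_n.+3(G)|%g = p ->
  ('L_n.+1(G) / 'L_n.+2(G) \subset 'Mho^1(Y / 'L_n.+2(G)))%g ->
  ('L_n.+2(G) \subset 'L_n.+3(G))%g.
Proof.
move=> pG sYG cYG iL sLM.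
have nL m : (G \subset 'N('L_m(G)))%g by rewrite lcn_norm.
have sL m : ('L_m(G) \subset G)%g by rewrite lcn_sub.
have LN m k : ('L_m(G) \subset 'N('L_k(G)))%g := subset_trans (sL m) (nL k).
(* Since [C] contains L_(n+2), the inclusion of L_(n+1) in [C] can be tested modulo L_(n+2). *)
pose C := (coset 'L_n.+3(G) @*^-1 'C(G / 'L_n.+3(G)))%G.
have memC x : (x \in G -> (x \in C) = (coset 'L_n.+3(G) x \in 'C(G / 'L_n.+3(G))))%g.
  move=> Gx; have Nx := subsetP (nL n.+3) x Gx.
  by rewrite /= morphpreE in_setI Nx [LHS]inE.
have cL : ('L_n.+2(G) / 'L_n.+3(G) \subset 'C(G / 'L_n.+3(G)))%g.
  by rewrite quotient_cents2 ?LN //= -lcnSn.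
have sL2C : ('L_n.+2(G) \subset C)%g.
  apply/subsetP=> x Lx; rewrite memC ?(subsetP (sL _) x Lx) //.
  by rewrite (subsetP cL) // mem_quotient.
have YpC y : (y \in Y -> y ^+ p \in C)%g.
  move=> Yy; have Gy := subsetP sYG y Yy; rewrite memC ?groupX //.
  apply/centP=> _ /morphimP[g Ng Gg ->].
  have NyL : (y \in 'N('L_n.+3(G)))%g by apply: (subsetP (nL _)).
  have Lyg : ([~ coset 'L_n.+3(G) y, coset 'L_n.+3(G) g]
              \in 'L_n.+2(G) / 'L_n.+3(G))%g.
    by rewrite -morphR // mem_quotient // (subsetP cYG) // mem_commg.
  (* [y, g] is central modulo L_(n+3), so [y^p, g] = [y, g]^p = 1 there. *)
  apply/commgP; rewrite morphX // commXg.
    rewrite -order_dvdn (dvdn_trans (order_dvdG Lyg)) //.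
    by rewrite card_quotient ?LN //= iL.
  apply/commute_sym; apply: (centP (subsetP cL _ Lyg)).
  by rewrite mem_quotient.
have sL1C : ('L_n.+1(G) \subset C)%g.
  rewrite -(quotientSGK _ sL2C) ?LN //.
  apply: (subset_trans sLM).
  rewrite (MhoE 1 (quotient_pgroup _ (pgroupS sYG pG))) gen_subG.
  apply/subsetP=> _ /imsetP[_ /morphimP[y Ny Yy ->] ->].
  by rewrite expn1 -morphX // mem_quotient // YpC.
rewrite {1}lcnSn -quotient_cents2 ?LN ?nL //.
by apply: subset_trans (quotientS _ sL1C) _; rewrite cosetpreK.
Qed.

(** G' is central modulo K, so G / Y is abelian and chi(1)^2 = |G : Y|. Modulo K, [x, w]^p =
    [x^p, w] = 1 because x^p is in G'; so G'K/K is a nontrivial subgroup of Ohm_1 of the cyclic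
    group Y/K, which has order p. *)
Lemma cfcenter_lcn3_ker {gT : finGroupType} {p : nat} {G : {group gT}} (i : Iirr G) :
  prime p -> p.-group%g G -> (forall x, x \in G -> x ^+ p \in G^`(1))%g ->
  ('L_3(G) \subset cfker 'chi_i)%g -> 'chi_i \isn't a linear_char ->
  let K := cfker 'chi_i in let Y := 'Z('chi_i)%CF in
  [/\ 'chi_i 1%g ^+ 2 = #|G : Y|%g%:R, #|G^`(1) / K|%g = p &
    #|Y / K|%g = p \/
    #|Y / K|%g = (p ^ 2)%N /\ (G^`(1) / K)%g = 'Mho^1(Y / K)%g].
Proof.
move=> p_pr pG expG sL3K; rewrite lin_irr_der1 => nsDK K Y.
have [sKG nKG] := andP (cfker_normal 'chi_i).
have eqYZ : (Y / K = 'Z(G / K))%g := cfcenter_eq_center i.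
have nKD : (G^`(1) \subset 'N(K))%g := subset_trans (der_sub 1 G) nKG.
have sDZ : (G^`(1) / K \subset Y / K)%g.
  rewrite eqYZ subsetI quotientS ?der_sub //=.
  by rewrite quotient_cents2 // -[G^`(1)%g]lcn2 -lcnSn.
have sKY : (K \subset Y)%g := normal_sub (cfker_center_normal 'chi_i).
have sDY : (G^`(1) \subset Y)%g by rewrite -(quotientSGK nKD sKY).
have chi2 : 'chi_i 1%g ^+ 2 = #|G : Y|%g%:R.
  exact: irr1_abelian_bound (sub_der1_abelian sDY).
have cycY : cyclic (Y / K)%g := cfcenter_cyclic 'chi_i.
have sYG : (Y \subset G)%g := cfcenter_sub 'chi_i.
have pY : p.-group%g (Y / K)%g by rewrite quotient_pgroup // (pgroupS sYG).
have ntD : (G^`(1) / K != 1)%g.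
  by rewrite -subG1 quotient_sub1.
have ntY : (Y / K != 1)%g.
  by apply: contra ntD => /eqP eY; rewrite -subG1 -eY.
have oOhm := Ohm1_cyclic_pgroup_prime cycY pY ntY.
have sDO : (G^`(1) / K \subset 'Ohm_1(Y / K))%g.
  rewrite quotient_der // gen_subG.
  apply/subsetP=> _ /imset2P[X W GX GW ->].
  rewrite /= (OhmE 1 pY) mem_gen //; apply/LdivP.
  have DXW : [~ X, W]%g \in (G^`(1) / K)%g by rewrite quotient_der // mem_commg.
  split; first exact: (subsetP sDZ).
  have ZXW : [~ X, W]%g \in 'Z(G / K)%g by rewrite -eqYZ (subsetP sDZ).
  rewrite expn1 -commXg; last by case/centerP: ZXW => _ cXW; exact/commute_sym/cXW.
  have [x Nx Gx ->] := morphimP GX; apply/eqP/commgP.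
  suffices /centerP[_] : (coset K x ^+ p \in 'Z(G / K))%g by apply.
  by rewrite -eqYZ (subsetP sDZ) // -morphX // mem_quotient ?expG.
have oD : #|G^`(1) / K|%g = p.
  have := cardSg sDO; rewrite oOhm => /(primeP p_pr).2 => /orP[/eqP D1|/eqP//].
  by case/negP: ntD; apply/eqP/card1_trivg.
split=> //.
(* All p-th powers lie in G', so Mho^1(Y/K) has order 1 or p, and |Y/K| is p times this order. *)
have sMD : ('Mho^1(Y / K) \subset G^`(1) / K)%g.
  rewrite (MhoE 1 pY) gen_subG.
  apply/subsetP=> _ /imsetP[_ /morphimP[y Ny Yy ->] ->].
  by rewrite expn1 -morphX // mem_quotient // expG // (subsetP sYG).
have := mul_card_Ohm_Mho_abelian 1 (cyclic_abelian cycY); rewrite oOhm => <-.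
have := cardSg sMD; rewrite oD => /(primeP p_pr).2 => /orP[/eqP ->|/eqP oM].
  by left; rewrite muln1.
right; rewrite oM mulnn; split=> //; apply/eqP.
by rewrite eq_sym eqEcard sMD oM oD /=.
Qed.

Lemma codegree_gap_lcn5 {gT : finGroupType} {p a : nat} {G : {group gT}}
    (i : Iirr G) :
  prime p -> p.-group%g G -> (4 <= a)%N -> codegree_gap p a G ->
  cfaithful 'chi_i -> 'L_5(G)%g = 1%g.
Proof.
move=> p_pr pG a4 gapG ffi; apply/eqP/negPn/negP=> ntL5.
have ntL m : (m <= 5)%N -> 'L_m(G)%g != 1%g.
  move=> m5; apply: contra ntL5 => /eqP L1.
  by rewrite -subG1 -L1 lcn_sub_leq.
have pL m : #|'L_m(G)%g| = (p ^ logn p #|'L_m(G)%g|)%N.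
  by rewrite -card_pgroup // (pgroupS (lcn_sub m G)).
have ltL m : (m < 5)%N ->
    (logn p #|'L_m.+2(G)%g| < logn p #|'L_m.+1(G)%g|)%N.
  move=> m5; rewrite -(ltn_exp2l _ _ (prime_gt1 p_pr)) -!pL proper_card //.
  rewrite lcnSn; apply: nil_comm_properl (pgroup_nil pG) _ _ _ => /=.
  - exact: lcn_sub.
  - exact: ntL.
  - by rewrite subsetI subxx lcn_norm.
have ntG : G != 1%g :> {set gT} by apply: (ntL 1%N).
have cardG := codegree_gap_faithful i p_pr pG (ltnW (ltnW a4)) gapG ntG ffi.
have nsL23 : ~~ ('L_2(G) \subset 'L_3(G))%g.
  apply: contraL (ltL 1%N isT) => sL; rewrite -leqNgt dvdn_leq_log //.
  exact: cardSg.
(* L_3 is the intersection of the irreducible kernels containing it; were all these characters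
   linear, G' = L_2 would lie in L_3. *)
have [j sL3K lin'j] : exists2 j : Iirr G, ('L_3(G) \subset cfker 'chi_j)%g
    & 'chi_j \isn't a linear_char.
  apply/exists_inP; apply: contraR nsL23 => /exists_inPn lin.
  rewrite -(cap_cfker_normal (lcn_normal 3 G)); apply/bigcapsP=> j sLK.
  by rewrite lcn2 -lin_irr_der1; have := lin j sLK; rewrite negbK.
have [chi2 oD oY] := cfcenter_lcn3_ker j p_pr pG
  (fun x => codegree_gap_expg x p_pr a4 gapG) sL3K lin'j.
set K := cfker 'chi_j in oD oY; set Y := 'Z('chi_j)%CF in chi2 oY.
have [f chi1] := irr1_pgroup j p_pr pG.
have [k ck gk] := gapG j.
have oGK := index_cfker_codegree p_pr chi1 ck.
have oGY : #|G : Y|%g = (p ^ f.*2)%N.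
  by apply/eqP; rewrite -(eqr_nat algC) -chi2 chi1 -natrX -expnM muln2.
have f_gt0 : (0 < f)%N.
  rewrite lt0n; apply: contraNneq lin'j => f0.
  by rewrite qualifE /= irr_char chi1 f0 eqxx.
have sKG : (K \subset G)%g := cfker_sub 'chi_j.
have sKY : (K \subset Y)%g := normal_sub (cfker_center_normal 'chi_j).
have sYG : (Y \subset G)%g := cfcenter_sub 'chi_j.
have nKG : (G \subset 'N(K))%g := cfker_norm 'chi_j.
have oYK : #|Y / K|%g = #|Y : K|%g.
  by rewrite card_quotient // (subset_trans sYG).
have oGYK : (p ^ (k + f) = p ^ f.*2 * #|Y / K|%g)%N.
  by rewrite oYK -oGY -oGK (Lagrange_index sYG sKY).
have sDG := der_sub 1 G.
have oDK : (#|G^`(1)%g| = p * #|G^`(1) :&: K|%g)%N.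
  rewrite -oD card_quotient ?(subset_trans sDG) //.
  by rewrite -indexgI mulnC Lagrange ?subsetIl.
have oL2 : #|'L_2(G)%g| = #|G^`(1)%g| by rewrite lcn2.
have pK : p.-group%g K := pgroupS sKG pG.
have oK : #|K| = (p ^ logn p #|K|)%N by rewrite -card_pgroup.
have oI : (#|G^`(1) :&: K|%g = p ^ logn p #|G^`(1) :&: K|%g)%N.
  by rewrite -card_pgroup // (pgroupS (subsetIr _ _)).
have leIK : (logn p #|G^`(1) :&: K|%g <= logn p #|K|)%N.
  by rewrite dvdn_leq_log // cardSg ?subsetIr.
have eqL2 : (logn p #|'L_2(G)%g| = 1 + logn p #|G^`(1) :&: K|%g)%N.
  by rewrite oL2 oDK oI -expnS !pfactorK.
have leG : (logn p #|K| + (k + f) <= a.*2.-1)%N.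
  by rewrite -(leq_exp2l _ _ (prime_gt1 p_pr)) expnD -oK -oGK Lagrange.
have := ltL 1%N isT; have := ltL 2%N isT; have := ltL 3%N isT => lt3 lt2 lt1.
have d5 : (0 < logn p #|'L_5(G)%g|)%N.
  by rewrite lt0n; apply: contraNneq ntL5 => d0; rewrite trivg_card1 pL d0.
case: oY => [oY | [oY eqMho]].
  (* Here k = f + 1 >= 2, so k >= a - 1 and |K| <= p^(2(a-k)) <= p^2. Then |L_2| <= p^3, too small
     for L_2 > L_3 > L_4 > L_5 > 1. *)
  move: oGYK; rewrite oY -expnSr => /eqP; rewrite eqn_exp2l ?prime_gt1 //.
  move/eqP=> ekf; exfalso.
  by clear -ekf gk a4 f_gt0 leG eqL2 leIK lt1 lt2 lt3 d5; lia.
move: oGYK; rewrite oY -expnD => /eqP; rewrite eqn_exp2l ?prime_gt1 //.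
move/eqP=> ekf.
(* Now k = f + 2 >= 3, so k >= a - 1 and |K| <= p^(2(a-k)+1) <= p^3. Then |L_2| <= p^4, and the
   strict chain below L_2 forces every order. *)
have [d3 d4 dK] : [/\ logn p #|'L_3(G)%g| = 3, logn p #|'L_4(G)%g| = 2
    & logn p #|K| = 3].
  by clear -ekf gk a4 f_gt0 leG eqL2 leIK lt1 lt2 lt3 d5; split; lia.
have eqKL : 'L_3(G)%g = K.
  by apply/eqP; rewrite eqEcard sL3K /= oK dK pL d3.
have := lcn_Mho1_central (n := 1) (Y := [group of Y]) pG sYG.
rewrite /= eqKL => sL34.
have {sL34}: (K \subset 'L_4(G))%g.
  apply: sL34.
  - rewrite -quotient_cents2 ?(subset_trans sYG) //.
    by rewrite /Y /K cfcenter_eq_center subsetIr.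
  - have sL43 : ('L_4(G) \subset K)%g by rewrite -eqKL lcn_sub_leq.
    by rewrite -divgS // oK dK pL d4 -expnB ?prime_gt0.
  - by rewrite [X in (X / _)%g]lcn2 eqMho.
rewrite -eqKL => /subset_leq_card; rewrite pL [X in (_ <= X)%N]pL d3 d4.
by rewrite leq_exp2l ?prime_gt1.
Qed.

Theorem theorem1p5 (gT : finGroupType) (G : {group gT}) (p a : nat) :
  prime p -> pgroup p G -> (4 <= a)%N ->
  (forall c : algC, c \in cod G <->
     (c = 1 \/ c = p%:R \/ c = (p ^ a.-1)%:R \/ c = (p ^ a)%:R)) ->
  (nil_class G <= a)%N.
Proof.
move=> p_pr pG a4 codG; apply: leq_trans (a4).
have gapG : codegree_gap p a G.
  move=> i; have : codegree i \in cod G by apply/existsP; exists i.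
  case/codG=> [->|[->|[->|->]]]; [exists 0%N | exists 1%N | exists a.-1 | exists a];
    by rewrite ?expn1 // !leqnn leq_pred orbT.
(* Class at most 4 means L_5(G) = 1. It suffices that L_5(G) lies in each irreducible kernel, that
   is, that L_5 vanishes in G / ker chi, where chi becomes faithful. *)
apply/(lcn_nil_classP _ (pgroup_nil pG))/trivgP; rewrite -(TI_cfker_irr G).
apply/bigcapsP=> i _; have [_ nKG] := andP (cfker_normal 'chi_i).
rewrite -quotient_sub1 ?(subset_trans (lcn_sub _ _)) // subG1.
rewrite /= quotientE morphim_lcn // -quotientE; apply/eqP.
apply: (codegree_gap_lcn5 (quo_Iirr (cfker_group 'chi_i) i) p_pr _ a4).
- exact: quotient_pgroup.
- exact: codegree_gap_quotient (cfker_normal _) gapG.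
- by rewrite quo_IirrE ?cfker_normal // cfaithful_quo.
Qed.
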